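(* Let $M\subseteq\mathbb{R}^m$ be nonempty, let $F:M\to L(E^n)$ be a fuzzy $n$-cell number-valued function and let $t\in M$. Then the subdifferential $\partial F(t)$ is a closed subset of $(L(E^n))^m$.
   Context: A fuzzy set is a function $u:\mathbb{R}^n\to[0,1]$; its level sets are $[u]^r=\{x:u(x)\ge r\}$ for $r\in(0,1]$ and $[u]^0=\overline{\{x:u(x)>0\}}$. $u$ is a fuzzy number ($u\in E^n$) if $u(x_0)=1$ for some $x_0$, $u(\lambda x+(1-\lambda)y)\ge\min(u(x),u(y))$ for all $x,y$ and $\lambda\in[0,1]$, $u$ is upper semicontinuous, and $[u]^0$ is compact. $L(E^n)$ (the fuzzy $n$-cell numbers) is the set of $u\in E^n$ with $[u]^r=\prod_{i=1}^n[u_i^-(r),u_i^+(r)]$ for all $r\in[0,1]$. Addition and scalar multiplication are levelwise: $[u+v]^r=[u]^r+[v]^r$, $[ku]^r=k[u]^r$. Order on $L(E^n)$: $u\le v$ iff $u_i^-(r)\le v_i^-(r)$ and $u_i^+(r)\le v_i^+(r)$ for all $i$ and all $r\in[0,1]$. Metric: $D_L(u,v)=\sup_{r\in[0,1]}\max_{1\le i\le n}\{|u_i^-(r)-v_i^-(r)|,|u_i^+(r)-v_i^+(r)|\}$. Convergence in $(L(E^n))^m$ means convergence of each component with respect to $D_L$, and closedness is with respect to this convergence. For boxes $A,B$ in $\mathbb{R}^n$, $A\ominus_{gH}B=C$ means $A=B+C$ or $B=A+(-1)C$. The $g$-difference $u\ominus_g v$ is the fuzzy number with level sets $[u\ominus_g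 v]^r=\mathrm{cl}\big(\mathrm{conv}\bigcup_{\beta\ge r}([u]^\beta\ominus_{gH}[v]^\beta)\big)$, $r\in[0,1]$; it need not exist. If it exists for $u,v\in L(E^n)$, then $[u\ominus_g v]^r=\prod_{i=1}^n[\inf_{\beta\ge r}\min\{u_i^-(\beta)-v_i^-(\beta),u_i^+(\beta)-v_i^+(\beta)\},\ \sup_{\beta\ge r}\max\{u_i^-(\beta)-v_i^-(\beta),u_i^+(\beta)-v_i^+(\beta)\}]$. For $v=(v_1,\dots,v_m)\in(L(E^n))^m$ and $d\in\mathbb{R}^m$, $v\cdot d=\sum_{j=1}^m d_jv_j\in L(E^n)$. A vector $v\in(L(E^n))^m$ is a subgradient of $F$ at $t\in M$ if for every $z\in M$ the $g$-difference $F(z)\ominus_gF(t)$ exists and $F(z)\ominus_gF(t)\ge v\cdot(z-t)$; $\partial F(t)$ is the set of all subgradients of $F$ at $t$. *)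

(* Defs.v *)
From HB Require Import structures.
From mathcomp Require Import all_boot all_order all_algebra.
From mathcomp Require Import all_classical all_reals all_analysis.
From mathcomp Require Import lra.

Set Implicit Arguments.
Unset Strict Implicit.
Unset Printing Implicit Defensive.

Import Order.TTheory GRing.Theory Num.Theory.
Import numFieldNormedType.Exports.

Local Open Scope classical_set_scope.
Local Open Scope ring_scope.

Section boxes.
Context {R : realType} {n : nat}.
Implicit Types (A B : set 'rV[R]_n) (a b : 'I_n -> R).

Definition box a b : set 'rV[R]_n :=
  [set x | forall i, a i <= x ord0 i <= b i].

Definition is_box A : Prop :=
  exists a b, (forall i, a i <= b i) /\ A = box a b.

Definition minkowski_add A B : set 'rV[R]_n :=
  [set z | exists x y, [/\ A x, B y & z = x + y]].

Definition minkowski_scale (k : R) A : set 'rV[R]_n :=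
  [set k *: x | x in A].

(* The difference is a relation: it does not exist for all pairs of boxes
   when n > 1. *)
Definition is_gHdiff A B C : Prop :=
  is_box C /\
  (A = minkowski_add B C \/ B = minkowski_add A (minkowski_scale (-1) C)).

Definition convex_hull A : set 'rV[R]_n :=
  smallest (@convex_set R 'rV[R]_n) A.

End boxes.

Section fuzzy_numbers.
Context {R : realType} {n : nat}.
Implicit Types u v w : 'rV[R]_n -> R.

(* Only meaningful for 0 <= r <= 1. *)
Definition level u (r : R) : set 'rV[R]_n :=
  if r == 0 then closure [set x | 0 < u x] else [set x | r <= u x].

Definition upper_semicontinuous u : Prop :=
  forall x a, u x < a -> \forall y \near x, u y < a.

Record fuzzy_number u : Prop := FuzzyNumber {
  fuzzy_range : forall x, 0 <= u x <= 1 ;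
  fuzzy_normal : exists x0, u x0 = 1 ;
  fuzzy_quasiconcave : forall x y l, 0 <= l <= 1 ->
    Num.min (u x) (u y) <= u (l *: x + (1 - l) *: y) ;
  fuzzy_usc : upper_semicontinuous u ;
  fuzzy_compact : compact (level u 0) }.

(* Existence of the difference on every level, 0 <= beta <= 1, is part of the
   existence of the g-difference. *)
Definition is_gdiff u v w : Prop :=
  fuzzy_number w /\
  exists C : R -> set 'rV[R]_n,
    (forall beta, 0 <= beta <= 1 ->
       is_gHdiff (level u beta) (level v beta) (C beta)) /\
    (forall r, 0 <= r <= 1 ->
       level w r =
       closure (convex_hull (\bigcup_(beta in `[r, 1]%classic) C beta))).

End fuzzy_numbers.

Record ncell (R : realType) (n : nat) := NCell {
  ncell_fun :> 'rV[R]_n -> R ;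
  ncell_fuzzy : fuzzy_number ncell_fun ;
  ncell_box : forall r, 0 <= r <= 1 -> is_box (level ncell_fun r) }.

Section endpoints.
Context {R : realType} {n : nat}.
Implicit Types u v : ncell R n.

(* u_i^-(r) and u_i^+(r); see [level_ncellE]. *)
Definition lower u (r : R) (i : 'I_n) : R :=
  inf [set x ord0 i | x in level u r].
Definition upper u (r : R) (i : 'I_n) : R :=
  sup [set x ord0 i | x in level u r].

Definition ncell_le u v : Prop := forall i r, 0 <= r <= 1 ->
  lower u r i <= lower v r i /\ upper u r i <= upper v r i.

(* The set is bounded above ([ncell_dist_has_sup]), so the supremum is not the
   default value 0. *)
Definition ncell_dist u v : R :=
  sup [set \big[Num.max/0]_(i < n)
             Num.max `|lower u r i - lower v r i| `|upper u r i - upper v r i|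
      | r in `[0, 1]%classic].

End endpoints.

Section box_theory.
Context {R : realType} {n : nat}.
Implicit Types (A B : set 'rV[R]_n) (a b : 'I_n -> R).

Lemma box_nonempty A : is_box A -> A !=set0.
Proof.
move=> [a [b [ab ->]]]; exists (\row_i a i) => i /=.
by rewrite mxE lexx ab.
Qed.

Lemma boxP a b : (forall i, a i <= b i) ->
  (forall i, inf [set x ord0 i | x in box a b] = a i) /\
  (forall i, sup [set x ord0 i | x in box a b] = b i).
Proof.
move=> ab.
have Ha : box a b (\row_i a i) by move=> i /=; rewrite mxE lexx ab.
have Hb : box a b (\row_i b i) by move=> i /=; rewrite mxE lexx ab.
split=> i; apply/eqP; rewrite eq_le; apply/andP; split.
- have H : has_lbound [set x ord0 i | x in box a b].
    by exists (a i) => _ [x xab <-]; case/andP: (xab i).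
  by apply: (ge_inf H); exists (\row_i a i) => //; rewrite mxE.
- apply: lb_le_inf; first by exists (a i), (\row_i a i) => //; rewrite mxE.
  by move=> _ [x xab <-]; case/andP: (xab i).
- apply: ge_sup; first by exists (a i), (\row_i a i) => //; rewrite mxE.
  by move=> _ [x xab <-]; case/andP: (xab i).
- have H : has_ubound [set x ord0 i | x in box a b].
    by exists (b i) => _ [x xab <-]; case/andP: (xab i).
  by apply: (ub_le_sup H); exists (\row_i b i) => //; rewrite mxE.
Qed.

Lemma box_compact a b : compact (box a b).
Proof.
have -> : box a b =
    [set v : 'rV[R]_n | forall i, `[a i, b i]%classic (v ord0 i)].
  by apply/seteqP; split=> x H i; move: (H i); rewrite /= in_itv.
apply: (@rV_compact R n (fun i => `[a i, b i]%classic)) => i.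
  exact: segment_compact.
Qed.

Lemma box_closed a b : closed (box a b).
Proof. exact: compact_closed (@norm_hausdorff _ _) (@box_compact a b). Qed.

Lemma box_convex a b x y l : 0 <= l <= 1 -> box a b x -> box a b y ->
  box a b (l *: x + (1 - l) *: y).
Proof.
move=> /andP[l0 l1] xab yab i; rewrite !mxE.
have /andP[? ?] := xab i; have /andP[? ?] := yab i.
by apply/andP; split; nra.
Qed.

Lemma minkowski_add_box a b a' b' :
    (forall i, a i <= b i) -> (forall i, a' i <= b' i) ->
  minkowski_add (box a b) (box a' b') =
  box (fun i => a i + a' i) (fun i => b i + b' i).
Proof.
move=> ab ab'; apply/seteqP; split.
  move=> _ [x [y [xab yab ->]]] i; rewrite mxE.
  have /andP[? ?] := xab i; have /andP[? ?] := yab i.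
  by apply/andP; split; lra.
move=> z zab.
exists (\row_i Num.max (a i) (z ord0 i - b' i)).
exists (\row_i (z ord0 i - Num.max (a i) (z ord0 i - b' i))).
split.
- move=> i; rewrite mxE le_max lexx /= ge_max ab /=.
  by rewrite lerBlDr; case/andP: (zab i).
- move=> i; rewrite mxE; case/andP: (zab i) => /= ? ?; have := ab' i.
  by case: (leP (a i) (z ord0 i - b' i)) => ? ?; apply/andP; split; lra.
- by apply/rowP => i; rewrite !mxE; lra.
Qed.

Lemma minkowski_add_is_box A B :
  is_box A -> is_box B -> is_box (minkowski_add A B).
Proof.
move=> [a [b [ab ->]]] [a' [b' [ab' ->]]]; rewrite minkowski_add_box//.
by do 2 eexists; split; [|reflexivity] => i /=; rewrite lerD.
Qed.

Lemma minkowski_scale0 A : A !=set0 -> minkowski_scale 0 A = [set 0].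
Proof.
move=> [x Ax]; apply/seteqP; split=> [_ [y _ <-]/=|_ ->]; first exact: scale0r.
by exists x => //; rewrite scale0r.
Qed.

Lemma minkowski_scaleP k A x : k != 0 ->
  minkowski_scale k A x <-> A (k^-1 *: x).
Proof.
move=> k0; split=> [[y Ay <-]|Ax]; first by rewrite scalerA mulVf// scale1r.
by exists (k^-1 *: x) => //; rewrite scalerA divff// scale1r.
Qed.

Lemma set1_is_box : is_box ([set 0] : set 'rV[R]_n).
Proof.
exists (fun=> 0), (fun=> 0); split=> //; apply/seteqP; split=> [_ -> i|x x0].
  by rewrite mxE lexx.
by apply/rowP => i; rewrite mxE; apply/eqP; rewrite eq_sym eq_le.
Qed.

Lemma minkowski_scale_is_box k A : is_box A -> is_box (minkowski_scale k A).
Proof.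
move=> boxA; have [->|k0] := eqVneq k 0.
  by rewrite (minkowski_scale0 (box_nonempty boxA)); exact: set1_is_box.
case: boxA => a [b [ab ->]].
have [kp|kn|/eqP] := ltrgtP 0 k; last by rewrite eq_sym (negbTE k0).
  exists (fun i => k * a i), (fun i => k * b i); split.
    by move=> i; rewrite ler_pM2l.
  apply/seteqP; split=> x.
    by move=> [y yab <-] i; rewrite mxE !ler_pM2l.
  move=> xab; apply/minkowski_scaleP => // i; rewrite mxE.
  by rewrite -(ler_pM2l kp) -[in X in _ && X](ler_pM2l kp) mulVKf.
exists (fun i => k * b i), (fun i => k * a i); split.
  by move=> i; rewrite ler_nM2l.
apply/seteqP; split=> x.
  by move=> [y yab <-] i; rewrite mxE !ler_nM2l// andbC.
move=> xab; apply/minkowski_scaleP => // i; rewrite mxE.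
by rewrite -(ler_nM2l kn) -[in X in _ && X](ler_nM2l kn) mulVKf// andbC.
Qed.

End box_theory.

Section level_families.
Context {R : realType} {n : nat}.
Implicit Types (A : R -> set 'rV[R]_n).

Record level_family A : Prop := LevelFamily {
  lf_box : forall r, 0 <= r <= 1 -> is_box (A r) ;
  lf_anti : forall r s, 0 <= r -> r <= s -> s <= 1 -> A s `<=` A r ;
  lf_left : forall r x, 0 < r <= 1 ->
    (forall s, 0 < s < r -> A s x) -> A r x ;
  lf_zero : A 0 `<=` closure (\bigcup_(s in `]0, 1]%classic) A s) }.

(* Here sup set0 = 0 is the right value. *)
Definition of_levels A (x : 'rV[R]_n) : R :=
  sup [set r | 0 <= r <= 1 /\ A r x].

Section of_levels_theory.
Variables (A : R -> set 'rV[R]_n) (famA : level_family A).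

Let of_levels_ub x : has_ubound [set r | 0 <= r <= 1 /\ A r x].
Proof. by exists 1 => r [/andP[]]. Qed.

Lemma of_levels_range x : 0 <= of_levels A x <= 1.
Proof.
rewrite /of_levels; have [[r Sr]|/set0P/negP/negPn/eqP ->] :=
    pselect ([set r | 0 <= r <= 1 /\ A r x] !=set0); last first.
  by rewrite sup0 lexx ler01.
apply/andP; split; last by apply: ge_sup; [exists r|move=> s [/andP[]]].
by case: (Sr) => /andP[r0 _] _; apply: (le_trans r0); exact: (ub_le_sup (of_levels_ub x) Sr).
Qed.

Lemma of_levels_ge r x : 0 < r <= 1 -> r <= of_levels A x <-> A r x.
Proof.
move=> /andP[r0 r1]; split=> [rA|Ar]; last first.
  by apply: (ub_le_sup (of_levels_ub x)); split=> //; rewrite (ltW r0).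
apply: (lf_left famA); first by rewrite r0.
move=> s /andP[s0 sr]; have := lt_le_trans sr rA; rewrite /of_levels => ssup.
have S0 : [set r | 0 <= r <= 1 /\ A r x] !=set0.
  apply/set0P; apply/eqP => S0; move: ssup; rewrite S0 sup0.
  by rewrite ltNge (ltW s0).
have [e [/andP[_ e1] Ae] se] := sup_gt S0 ssup.
by apply: (lf_anti famA) Ae => //; exact: ltW.
Qed.

Lemma of_levels_gt0 :
  [set x | 0 < of_levels A x] = \bigcup_(s in `]0, 1]%classic) A s.
Proof.
apply/seteqP; split=> x /=.
  move=> x0; exists (of_levels A x).
    by rewrite /= in_itv /= x0; case/andP: (of_levels_range x).
  apply/of_levels_ge; last exact: lexx.
  by rewrite x0; case/andP: (of_levels_range x).
move=> [s]; rewrite /= in_itv /= => /andP[s0 s1] As.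
by apply: (lt_le_trans s0); apply/of_levels_ge => //; rewrite s0.
Qed.

Lemma level_of_levels r : 0 <= r <= 1 -> level (of_levels A) r = A r.
Proof.
move=> /andP[r0 r1]; rewrite /level; case: eqP => [->|/eqP rn0].
  rewrite of_levels_gt0; apply/seteqP; split; last exact: (lf_zero famA).
  have [a [b [_ A0E]]] : is_box (A 0) by apply: lf_box; rewrite // lexx ler01.
  have -> : A 0 = closure (A 0).
    by apply/closure_id; rewrite A0E; exact: box_closed.
  apply: closure_subset => x [s]; rewrite /= in_itv /= => /andP[s0 s1].
  by apply: (lf_anti famA) => //; exact: ltW.
have rp : 0 < r <= 1 by rewrite lt_def rn0 r0.
by apply/seteqP; split=> x /=; move/(of_levels_ge x rp).
Qed.

Lemma of_levels_fuzzy : fuzzy_number (of_levels A).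
Proof.
split.
- exact: of_levels_range.
- have [|x Ax] := box_nonempty (@lf_box _ famA 1 _); first by rewrite ler01 lexx.
  exists x; apply/eqP; rewrite eq_le; case/andP: (of_levels_range x) => _ ->/=.
  by apply/of_levels_ge => //; rewrite ltr01 lexx.
- move=> x y l l01; set r := Num.min _ _.
  have [r0|r0] := leP r 0.
    by apply: (le_trans r0); case/andP: (of_levels_range (l *: x + (1 - l) *: y)).
  have r1 : 0 < r <= 1.
    rewrite r0 /r ge_min; apply/orP; left.
    by case/andP: (of_levels_range x).
  apply/of_levels_ge => //.
  have Ax : A r x by apply/of_levels_ge => //; rewrite /r ge_min lexx.
  have Ay : A r y by apply/of_levels_ge => //; rewrite /r ge_min lexx orbT.
  have [|a [b [_ ArE]]] := @lf_box _ famA r _.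
    by case/andP: r1 => /ltW -> ->.
  by move: Ax Ay; rewrite ArE; exact: box_convex.
- move=> x c xc; have c0 : 0 < c.
    by apply: le_lt_trans xc; case/andP: (of_levels_range x).
  have [c1|c1] := leP c 1; last first.
    apply: (@filterE _ (nbhs x)) => y; apply: le_lt_trans c1.
    by case/andP: (of_levels_range y).
  have c01 : 0 < c <= 1 by rewrite c0.
  have [|a [b [_ AcE]]] := @lf_box _ famA c _; first by rewrite (ltW c0).
  have oC : open (~` A c) by apply: closed_openC; rewrite AcE; exact: box_closed.
  have Cx : (~` A c) x by move=> /(of_levels_ge x c01); rewrite leNgt xc.
  apply: (@filterS _ (nbhs x) _ _ _ _ (open_nbhs_nbhs (conj oC Cx))) => y Cy.
  by rewrite ltNge; apply/negP => /(of_levels_ge y c01).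
- rewrite level_of_levels ?lexx ?ler01//.
  have [|a [b [_ ->]]] := @lf_box _ famA 0 _; first by rewrite lexx ler01.
  exact: box_compact.
Qed.

Lemma of_levels_box r : 0 <= r <= 1 -> is_box (level (of_levels A) r).
Proof. by move=> r01; rewrite level_of_levels//; exact: lf_box. Qed.

Definition ncell_of_levels : ncell R n := NCell of_levels_fuzzy of_levels_box.

End of_levels_theory.

Lemma level_ncell_family (u : ncell R n) : level_family (level u).
Proof.
have E s : 0 < s -> level u s = [set x | s <= u x].
  by move=> s0; rewrite /level gt_eqF.
split.
- by move=> r; exact: ncell_box.
- move=> r s r0 rs s1; have [->//|rns] := eqVneq r s.
  have {rns} rs' : r < s by rewrite lt_neqAle rns.
  have s0 := le_lt_trans r0 rs'; rewrite (E s s0) /level.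
  case: eqP => [_ x /= sx|_ x /=]; last exact: le_trans.
  by apply: subset_closure; exact: lt_le_trans sx.
- move=> r x /andP[r0 r1] H; rewrite E//=; rewrite leNgt; apply/negP => xr.
  have u0 : 0 <= u x by case/andP: (fuzzy_range (ncell_fuzzy u) x).
  have [h1 h2] := midf_lt xr; have s0 := le_lt_trans u0 h1.
  have sr : 0 < (u x + r) / 2 < r by rewrite s0.
  by have := H _ sr; rewrite E//= leNgt h1.
- rewrite {1}/level eqxx; apply: closure_subset => x /= x0.
  exists (u x); last by rewrite E /=.
  by rewrite /= in_itv /= x0; case/andP: (fuzzy_range (ncell_fuzzy u) x).
Qed.

End level_families.

Section operations.
Context {R : realType} {n : nat}.
Implicit Types (A B : R -> set 'rV[R]_n).

Let shift (x : 'rV[R]_n) (i : 'I_n) (c : R) : 'rV[R]_n :=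
  \row_j (if j == i then c else x ord0 j).

Lemma level_family_endpoints A a b : level_family A ->
    (forall r, 0 <= r <= 1 -> (forall i, a r i <= b r i) /\ A r = box (a r) (b r)) ->
  forall r i e, 0 < r <= 1 -> 0 < e ->
    exists2 s, 0 < s < r & forall s', s <= s' < r ->
      a r i - e <= a s' i /\ b s' i <= b r i + e.
Proof.
move=> famA E r i e /andP[r0 r1] e0.
have Hr : 0 <= r <= 1 by rewrite (ltW r0).
have sub s s' : 0 <= s -> s <= s' -> s' <= 1 ->
    forall j, a s j <= a s' j /\ b s' j <= b s j.
  move=> s0 ss' s1 j.
  have [abs As] := E s (introT andP (conj s0 (le_trans ss' s1))).
  have [abs' As'] := E s' (introT andP (conj (le_trans s0 ss') s1)).
  have /= := @lf_anti _ _ _ famA _ _ s0 ss' s1; rewrite As As' => sub.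
  have /sub/(_ j) : box (a s') (b s') (\row_i a s' i).
    by move=> k; rewrite mxE lexx abs'.
  have /sub/(_ j) : box (a s') (b s') (\row_i b s' i).
    by move=> k; rewrite mxE lexx abs'.
  by rewrite !mxE => /andP[_ ->] /andP[-> _].
have [ab ArE] := E r Hr.
have [s1 s1r Hs1] : exists2 s, 0 < s < r & a r i - e <= a s i.
  apply: contrapT => H.
  have H' s : 0 < s < r -> a s i < a r i - e.
    by move=> sr; rewrite ltNge; apply/negP => ?; apply: H; exists s.
  have : A r (shift (\row_j a r j) i (a r i - e)).
    apply: (lf_left famA); first by rewrite r0.
    move=> s sr; case/andP: (sr) => s0 /ltW sr'.
    have [_ ->] := E s (introT andP (conj (ltW s0) (le_trans sr' r1))).
    move=> j; have [h1 h2] := sub _ _ (ltW s0) sr' r1 j.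
    rewrite !mxE; case: eqP => [->|_]; last first.
      by rewrite h1 (le_trans (ab j)).
    have [{}h1 {}h2] := sub _ _ (ltW s0) sr' r1 i.
    by have := H' s sr; have := ab i; lra.
  by rewrite ArE => /(_ i); rewrite !mxE eqxx => /andP[]; lra.
have [s2 s2r Hs2] : exists2 s, 0 < s < r & b s i <= b r i + e.
  apply: contrapT => H.
  have H' s : 0 < s < r -> b r i + e < b s i.
    by move=> sr; rewrite ltNge; apply/negP => ?; apply: H; exists s.
  have : A r (shift (\row_j b r j) i (b r i + e)).
    apply: (lf_left famA); first by rewrite r0.
    move=> s sr; case/andP: (sr) => s0 /ltW sr'.
    have [_ ->] := E s (introT andP (conj (ltW s0) (le_trans sr' r1))).
    move=> j; have [h1 h2] := sub _ _ (ltW s0) sr' r1 j.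
    rewrite !mxE; case: eqP => [->|_]; last first.
      by rewrite h2 andbT (le_trans h1).
    have [{}h1 {}h2] := sub _ _ (ltW s0) sr' r1 i.
    by have := H' s sr; have := ab i; lra.
  by rewrite ArE => /(_ i); rewrite !mxE eqxx => /andP[]; lra.
case/andP: s1r => s10 s1r; case/andP: s2r => s20 s2r.
exists (Num.max s1 s2); first by rewrite lt_max s10 /= gt_max s1r s2r.
move=> s'; rewrite ge_max => /andP[/andP[h1 h2] h3].
have s'1 : s' <= 1 by apply: le_trans (ltW h3) r1.
have [? _] := sub _ _ (ltW s10) h1 s'1 i.
have [_ ?] := sub _ _ (ltW s20) h2 s'1 i.
by split; [exact: le_trans Hs1 _|exact: le_trans Hs2].
Qed.

Lemma level_family_choice A : level_family A -> exists a b,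
  forall r, 0 <= r <= 1 -> (forall i, a r i <= b r i) /\ A r = box (a r) (b r).
Proof.
move=> famA.
have /choice[f Hf] : forall r, exists f : ('I_n -> R) * ('I_n -> R),
    0 <= r <= 1 -> (forall i, f.1 i <= f.2 i) /\ A r = box f.1 f.2.
  move=> r; have [/(lf_box famA)[a [b ?]]|r01] := boolP (0 <= r <= 1).
    by exists (a, b).
  by exists (fun=> 0, fun=> 0).
by exists (fun r => (f r).1), (fun r => (f r).2).
Qed.

Lemma level_family_add A B : level_family A -> level_family B ->
  level_family (fun r => minkowski_add (A r) (B r)).
Proof.
move=> famA famB; split.
- by move=> r r01; apply: minkowski_add_is_box; exact: lf_box.
- move=> r s r0 rs s1 _ [x [y [Ax By ->]]]; exists x, y; split=> //.
  + exact: (lf_anti famA) Ax.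
  + exact: (lf_anti famB) By.
- have [a [b EA]] := level_family_choice famA.
  have [a' [b' EB]] := level_family_choice famB.
  move=> r x r01 H; have r01' : 0 <= r <= 1 by case/andP: r01 => /ltW -> ->.
  have E s : 0 <= s <= 1 -> minkowski_add (A s) (B s) =
      box (fun i => a s i + a' s i) (fun i => b s i + b' s i).
    move=> s01; have [? ->] := EA s s01; have [? ->] := EB s s01.
    exact: minkowski_add_box.
  rewrite E// => i.
  have P e : 0 < e ->
      a r i + a' r i - e <= x ord0 i /\ x ord0 i <= b r i + b' r i + e.
    move=> e0; have e2 : 0 < e / 2 by rewrite divr_gt0.
    have [s /andP[s0 sr] Hs] := level_family_endpoints famA EA i r01 e2.
    have [t /andP[t0 tr] Ht] := level_family_endpoints famB EB i r01 e2.
    set m := Num.max s t.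
    have mr : m < r by rewrite gt_max sr.
    have m0 : 0 < m by rewrite lt_max s0.
    have [|h1 h2] := Hs m; first by rewrite mr le_max lexx.
    have [|h3 h4] := Ht m; first by rewrite mr le_max lexx orbT.
    have m1 : 0 <= m <= 1.
      by rewrite (ltW m0) (le_trans (ltW mr))//; case/andP: r01.
    have := H m (introT andP (conj m0 mr)); rewrite E// => /(_ i)/andP[].
    by lra.
  apply/andP; split; apply/ler_addgt0Pr => e /P[]; lra.
- move=> _ [x [y [Ax By ->]]] N Nxy.
  have cadd := @add_continuous ('rV[R]_n : normedModType R) (x, y).
  have [/= [U V] /= [Ux Vy] UV] := cadd _ Nxy.
  have [x' [[s]]] := lf_zero famA Ax Ux.
  rewrite /= in_itv /= => /andP[s0 s1] Asx' Ux'.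
  have [y' [[t]]] := lf_zero famB By Vy.
  rewrite /= in_itv /= => /andP[t0 t1] Bty' Vy'.
  exists (x' + y'); split; last by apply: (UV (x', y')).
  exists (Num.min s t).
    by rewrite /= in_itv /= lt_min s0 t0 /= ge_min s1.
  exists x', y'; split=> //.
  + by apply: (lf_anti famA) Asx' => //; rewrite ?le_min ?(ltW s0) ?(ltW t0) ?ge_min ?lexx.
  + by apply: (lf_anti famB) Bty' => //; rewrite ?le_min ?(ltW s0) ?(ltW t0) ?ge_min ?lexx ?orbT.
Qed.

Lemma level_family_zero : level_family (fun=> [set 0 : 'rV[R]_n]).
Proof.
split.
- by move=> r _; exact: set1_is_box.
- by move=> r s _ _ _ x.
- move=> r x /andP[r0 r1] H; have r2 : 0 < r / 2 < r by lra.
  exact: H r2.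
- move=> x x0; apply: subset_closure; exists 1 => //.
  by rewrite /= in_itv /= ltr01 lexx.
Qed.

Lemma level_family_scale k A : level_family A ->
  level_family (fun r => minkowski_scale k (A r)).
Proof.
move=> famA.
have ne r : 0 <= r <= 1 -> A r !=set0 by move=> ?; exact/box_nonempty/lf_box.
split.
- by move=> r r01; apply: minkowski_scale_is_box; exact: lf_box.
- move=> r s r0 rs s1 _ [x Ax <-]; exists x => //.
  exact: (lf_anti famA) Ax.
- move=> r x /andP[r0 r1] H; have [k0|k0] := eqVneq k 0.
    have r2 : 0 < r / 2 < r by lra.
    have := H _ r2; rewrite k0 !minkowski_scale0//; apply: ne; lra.
  apply/minkowski_scaleP => //; apply: (lf_left famA); first by rewrite r0.
  by move=> s /H/(minkowski_scaleP _ _ k0).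
- move=> _ [x Ax <-] N Nx.
  have cs := @scaler_continuous R ('rV[R]_n : normedModType R) k x.
  have [x' [[s s01 Asx'] Nx']] := lf_zero famA Ax (cs _ Nx).
  by exists (k *: x'); split => //; exists s => //; exists x'.
Qed.

Definition ncell_zero : ncell R n := ncell_of_levels level_family_zero.

Definition ncell_add (u v : ncell R n) : ncell R n := ncell_of_levels
  (level_family_add (level_ncell_family u) (level_ncell_family v)).

Definition ncell_scale (k : R) (u : ncell R n) : ncell R n :=
  ncell_of_levels (level_family_scale k (level_ncell_family u)).

Lemma level_ncell_zero r : 0 <= r <= 1 -> level ncell_zero r = [set 0].
Proof. by move=> r01; exact: (level_of_levels level_family_zero). Qed.

Lemma level_ncell_add u v r : 0 <= r <= 1 ->
  level (ncell_add u v) r = minkowski_add (level u r) (level v r).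
Proof.
move=> r01; apply: level_of_levels r01.
exact: level_family_add (level_ncell_family u) (level_ncell_family v).
Qed.

Lemma level_ncell_scale k u r : 0 <= r <= 1 ->
  level (ncell_scale k u) r = minkowski_scale k (level u r).
Proof.
move=> r01; apply: level_of_levels r01.
exact: level_family_scale (level_ncell_family u).
Qed.

Lemma level_ncellE (u : ncell R n) r : 0 <= r <= 1 ->
  (forall i, lower u r i <= upper u r i) /\
  level u r = box (lower u r) (upper u r).
Proof.
move=> r01; have [a [b [ab E]]] := ncell_box u r01.
have [inf_a sup_b] := boxP ab.
have la : lower u r = a by apply/funext => i; rewrite /lower E inf_a.
have ub : upper u r = b by apply/funext => i; rewrite /upper E sup_b.
by rewrite la ub.
Qed.

Lemma ncell_dist_has_sup (u v : ncell R n) :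
  has_sup [set \big[Num.max/0]_(i < n)
             Num.max `|lower u r i - lower v r i| `|upper u r i - upper v r i|
      | r in `[0, 1]%classic].
Proof.
split.
  by eexists; exists 0 => //; rewrite /= in_itv /= lexx ler01.
have B (w : ncell R n) r i : 0 <= r <= 1 -> lower w 0 i <= lower w r i /\
    lower w r i <= upper w r i /\ upper w r i <= upper w 0 i.
  move=> /andP[r0 r1].
  have [ab0 E0] : (forall i, lower w 0 i <= upper w 0 i) /\
    level w 0 = box (lower w 0) (upper w 0) by apply: level_ncellE; lra.
  have [ab E] : (forall i, lower w r i <= upper w r i) /\
    level w r = box (lower w r) (upper w r) by apply: level_ncellE; lra.
  have := lf_anti (level_ncell_family w) (lexx 0) r0 r1; rewrite E0 E => sub.
  have /sub/(_ i) : box (lower w r) (upper w r) (\row_i lower w r i).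
    by move=> k; rewrite mxE lexx ab.
  have /sub/(_ i) : box (lower w r) (upper w r) (\row_i upper w r i).
    by move=> k; rewrite mxE lexx ab.
  by rewrite !mxE ab => /andP[_ ->] /andP[-> _].
exists (\sum_(i < n) (`|lower u 0 i| + `|upper u 0 i|
                      + (`|lower v 0 i| + `|upper v 0 i|))).
move=> y [r]; rewrite /= in_itv /= => r01 <-{y}.
apply: bigmax_le; first by apply: sumr_ge0 => i _; rewrite !addr_ge0.
move=> i _; rewrite (bigD1 i)//=; apply: ler_wpDr.
  by apply: sumr_ge0 => j _; rewrite !addr_ge0.
have [? [? ?]] := B u r i r01; have [? [? ?]] := B v r i r01.
have := ler_norm (upper u 0 i); have := ler_norm (upper v 0 i).
have := ler_norm (- lower u 0 i); have := ler_norm (- lower v 0 i).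
have := normr_ge0 (upper u 0 i); have := normr_ge0 (upper v 0 i).
have := normr_ge0 (lower u 0 i); have := normr_ge0 (lower v 0 i).
rewrite !normrN => H1 H2 H3 H4 H5 H6 H7 H8.
rewrite ge_max !ler_norml; apply/andP; split; apply/andP; split; lra.
Qed.

End operations.

Section subdifferential.
Context {R : realType} {n m : nat}.

(* [level_ncell_zero], [level_ncell_add] and [level_ncell_scale] give the level
   sets of the operations. *)
Definition ncell_dot (v : 'I_m -> ncell R n) (d : 'rV[R]_m) : ncell R n :=
  \big[ncell_add/ncell_zero]_(j < m) ncell_scale (d ord0 j) (v j).

Definition subgradient (M : set 'rV[R]_m) (F : M -> ncell R n) (t : M)
    (v : 'I_m -> ncell R n) : Prop :=
  forall z : M, exists g : ncell R n,
    is_gdiff (F z) (F t) g /\ ncell_le (ncell_dot v (val z - val t)) g.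

Definition subdifferential (M : set 'rV[R]_m) (F : M -> ncell R n) (t : M) :
    set ('I_m -> ncell R n) :=
  [set v | subgradient F t v].

Definition ncell_vec_cvg (V : nat -> 'I_m -> ncell R n)
    (v : 'I_m -> ncell R n) : Prop :=
  forall j, ncell_dist (V k j) (v j) @[k --> \oo] --> (0 : R).

Definition ncell_vec_closed (S : set ('I_m -> ncell R n)) : Prop :=
  forall V v, (forall k, S (V k)) -> ncell_vec_cvg V v -> S v.

End subdifferential.

(* Main.v *)
(** The gH-difference of two boxes is unique when it exists, so the g-difference
    of F(z) and F(t) does not depend on the subgradient that witnesses its
    existence. The subgradient inequality then bounds the endpoints of
    v . (z - t) by fixed numbers, and these endpoints depend continuously on
    those of v, hence on v in the metric D_L. *)
Require Import Defs.
From mathcomp Require Import all_boot all_order all_algebra.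
From mathcomp Require Import all_classical all_reals all_analysis.
From mathcomp Require Import lra.

Set Implicit Arguments.
Unset Strict Implicit.
Unset Printing Implicit Defensive.

Import Order.TTheory GRing.Theory Num.Theory.
Import numFieldNormedType.Exports.

Local Open Scope classical_set_scope.
Local Open Scope ring_scope.

Section boxes.
Context {R : realType} {n : nat}.
Implicit Types (A B C : set 'rV[R]_n) (a b : 'I_n -> R).

(** A nonempty box determines its endpoints, as the infimum and supremum of each coordinate over it;
    empty boxes are excluded by the order hypotheses. *)
Lemma box_inj a b a' b' : (forall i, a i <= b i) -> (forall i, a' i <= b' i) ->
  box a b = box a' b' -> a = a' /\ b = b'.
Proof.
move=> ab ab' E; have [infE supE] := boxP ab; have [infE' supE'] := boxP ab'.
by split; apply/funext => i;
  rewrite -?infE -?infE' -?supE -?supE' E.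
Qed.

Lemma minkowski_scale_box k a b : (forall i, a i <= b i) ->
  minkowski_scale k (box a b) =
  box (fun i => Num.min (k * a i) (k * b i)) (fun i => Num.max (k * a i) (k * b i)).
Proof.
move=> ab; apply/seteqP; split=> [_ [y yab <-] i|x xab].
  rewrite mxE ge_min le_max; have /andP[ay yb] := yab i.
  have [k0|/ltW k0] := leP 0 k.
    by rewrite (ler_wpM2l k0 ay) (ler_wpM2l k0 yb) orbT.
  by rewrite (ler_wnM2l k0 ay) (ler_wnM2l k0 yb) orbT.
(* A preimage of [x] under scaling. For [k = 0] the box collapses to the origin and any point of
   [box a b] will do; the corner [a] is taken. *)
exists (\row_i (if k == 0 then a i else k^-1 * x ord0 i)); last first.
  apply/rowP => i; rewrite !mxE; case: eqP => [k0|/eqP k0]; last exact: mulVKf.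
  have := xab i; rewrite /= k0 !mul0r minxx maxxx => x0.
  by apply/eqP; rewrite eq_le.
move=> i; rewrite mxE; have := xab i; have := ab i => /= abi.
have [k0|k0|_] := ltrgtP k 0; last by rewrite lexx abi.
- rewrite min_r ?max_l ?ler_wnM2l ?(ltW k0)// => kx.
  by rewrite -(ler_nM2l k0) -[in X in _ && X](ler_nM2l k0) mulVKf ?lt_eqF// andbC.
- rewrite min_l ?max_r ?ler_wpM2l ?(ltW k0)// => kx.
  by rewrite -(ler_pM2l k0) -[in X in _ && X](ler_pM2l k0) mulVKf ?gt_eqF.
Qed.

(** The two alternatives of the gH-difference lead to one formula. The first makes the lower and
    upper endpoints of [C] equal to [a - a'] and [b - b'], the second to [b - b'] and [a - a']. As
    [C] is a box, its lower endpoint is the smaller of the two in every coordinate. *)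
Lemma gHdiff_box a b a' b' C :
    (forall i, a i <= b i) -> (forall i, a' i <= b' i) ->
  is_gHdiff (box a b) (box a' b') C ->
  C = box (fun i => Num.min (a i - a' i) (b i - b' i))
          (fun i => Num.max (a i - a' i) (b i - b' i)).
Proof.
move=> ab ab' [[c [d [cd ->]]] [E|E]].
  move: E; rewrite minkowski_add_box// => /box_inj[//|i|aE bE].
    by rewrite lerD.
  congr box; apply/funext => i; have := cd i; rewrite aE bE => ?;
    by [rewrite min_l; lra|rewrite max_r; lra].
move: E; rewrite minkowski_scale_box// minkowski_add_box//; last first.
  by move=> i; rewrite ge_min !le_max !lexx orbT.
have E1 i : Num.min (-1 * c i) (-1 * d i) = - d i.
  by rewrite !mulN1r min_r// lerN2.
have E2 i : Num.max (-1 * c i) (-1 * d i) = - c i.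
  by rewrite !mulN1r max_l// lerN2.
move=> /box_inj[//|i|aE bE].
  by rewrite E1 E2; have := ab i; have := cd i; lra.
congr box; apply/funext => i; have := cd i; rewrite aE bE E1 E2 => ?;
  by [rewrite min_r; lra|rewrite max_l; lra].
Qed.

Lemma gHdiff_unique A B C C' : is_box A -> is_box B ->
  is_gHdiff A B C -> is_gHdiff A B C' -> C = C'.
Proof.
move=> [a [b [ab ->]]] [a' [b' [ab' ->]]].
by move=> /(gHdiff_box ab ab') -> /(gHdiff_box ab ab') ->.
Qed.

End boxes.

Section gdifference.
Context {R : realType} {n : nat}.
Implicit Types u v g h : ncell R n.

(** The level at [r] is built from the gH-differences at [beta] in [[r, 1]], and each of these is
    unique. The families [C] and [C'] may differ outside [[0, 1]], so they are compared on that
    range only. *)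
Lemma gdiff_level_unique u v g h r : 0 <= r <= 1 ->
  is_gdiff u v g -> is_gdiff u v h -> level g r = level h r.
Proof.
move=> r01 [_ [C [gHC ->//]]] [_ [C' [gHC' ->//]]].
congr (closure (convex_hull _)); apply: eq_bigcupr => s.
rewrite /= in_itv /= => /andP[rs s1].
have s01 : 0 <= s <= 1 by rewrite s1 andbT; case/andP: r01 => /le_trans ->.
exact: gHdiff_unique (ncell_box u s01) (ncell_box v s01) (gHC s s01) (gHC' s s01).
Qed.

Lemma ncell_le_level u g h : (forall r, 0 <= r <= 1 -> level g r = level h r) ->
  ncell_le u g -> ncell_le u h.
Proof. by move=> E ug i r r01; rewrite /lower /upper -(E r r01); exact: ug. Qed.

End gdifference.

Section endpoint_convergence.
Context {R : realType} {n : nat}.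
Implicit Types (u v : ncell R n) (U V : nat -> ncell R n).

Lemma endpoints_level u r a b : (forall i, a i <= b i) ->
  level u r = box a b -> lower u r = a /\ upper u r = b.
Proof.
move=> ab E; have [infE supE] := boxP ab.
by split; apply/funext => i; rewrite /lower /upper E ?infE ?supE.
Qed.

Lemma endpoints_add u v r i : 0 <= r <= 1 ->
  lower (ncell_add u v) r i = lower u r i + lower v r i /\
  upper (ncell_add u v) r i = upper u r i + upper v r i.
Proof.
move=> r01; have [leu Eu] := level_ncellE u r01; have [lev Ev] := level_ncellE v r01.
have := level_ncell_add u v r01; rewrite Eu Ev minkowski_add_box//.
by move=> /endpoints_level[j|-> ->//]; rewrite lerD.
Qed.

Lemma endpoints_scale k u r i : 0 <= r <= 1 ->
  lower (ncell_scale k u) r i = Num.min (k * lower u r i) (k * upper u r i) /\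
  upper (ncell_scale k u) r i = Num.max (k * lower u r i) (k * upper u r i).
Proof.
move=> r01; have [leu Eu] := level_ncellE u r01.
have := level_ncell_scale k u r01; rewrite Eu minkowski_scale_box//.
by move=> /endpoints_level[j|-> ->//]; rewrite ge_min !le_max !lexx orbT.
Qed.

(** Convergence at each [r] separately, without the uniformity of D_L. It suffices because the order
    is also tested at each [r] separately. *)
Definition endpoint_cvg U u : Prop := forall i r, 0 <= r <= 1 ->
  (lower (U k) r i @[k --> \oo] --> lower u r i) /\
  (upper (U k) r i @[k --> \oo] --> upper u r i).

Lemma ncell_dist_ge u v r i : 0 <= r <= 1 ->
  `|lower u r i - lower v r i| <= ncell_dist u v /\
  `|upper u r i - upper v r i| <= ncell_dist u v.
Proof.
move=> r01; have [_ ub] := ncell_dist_has_sup u v.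
suff : Num.max `|lower u r i - lower v r i| `|upper u r i - upper v r i|
       <= ncell_dist u v by rewrite ge_max => /andP.
apply: le_trans (ub_le_sup ub _); last by exists r => //; rewrite /= in_itv.
exact: (le_bigmax_cond _ (fun i => Num.max `|lower u r i - lower v r i|
                                     `|upper u r i - upper v r i|)).
Qed.

Lemma dist_cvg_endpoint U u :
  ncell_dist (U k) u @[k --> \oo] --> (0 : R) -> endpoint_cvg U u.
Proof.
move=> Uu i r r01; split; apply/subr_cvg0/norm_cvg0P;
  apply: (squeeze_cvgr _ (cvg_cst 0) Uu); apply: nearW => k;
  by rewrite normr_ge0; have [] := ncell_dist_ge (U k) u i r01.
Qed.

Lemma endpoint_cvg_cst u : endpoint_cvg (fun=> u) u.
Proof. by move=> i r _; split; exact: cvg_cst. Qed.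

Lemma endpoint_cvg_add U V u v : endpoint_cvg U u -> endpoint_cvg V v ->
  endpoint_cvg (fun k => ncell_add (U k) (V k)) (ncell_add u v).
Proof.
move=> Uu Vv i r r01; have [Ul Uu'] := Uu i r r01; have [Vl Vu] := Vv i r r01.
have [-> ->] := endpoints_add u v i r01.
under eq_cvg do rewrite (endpoints_add _ _ i r01).1.
under [X in _ /\ X]eq_cvg do rewrite (endpoints_add _ _ i r01).2.
by split; exact: cvgD.
Qed.

(** A negative [c] swaps the endpoints; writing the new ones as a min and a max, which are
    continuous, treats all signs of [c] at once. *)
Lemma endpoint_cvg_scale c U u : endpoint_cvg U u ->
  endpoint_cvg (fun k => ncell_scale c (U k)) (ncell_scale c u).
Proof.
move=> Uu i r r01; have [Ul Uu'] := Uu i r r01.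
have [-> ->] := endpoints_scale c u i r01.
under eq_cvg do rewrite (endpoints_scale _ _ i r01).1.
under [X in _ /\ X]eq_cvg do rewrite (endpoints_scale _ _ i r01).2.
have cl : c * lower (U k) r i @[k --> \oo] --> c * lower u r i.
  exact: cvgM (cvg_cst c) Ul.
have cu : c * upper (U k) r i @[k --> \oo] --> c * upper u r i.
  exact: cvgM (cvg_cst c) Uu'.
split.
- exact: (cvg_comp2 cl cu (@min_continuous _ R (_, _))).
- exact: (cvg_comp2 cl cu (@max_continuous _ R (_, _))).
Qed.

Lemma endpoint_cvg_dot m (V : nat -> 'I_m -> ncell R n) (v : 'I_m -> ncell R n)
    (d : 'rV[R]_m) :
  ncell_vec_cvg V v ->
  endpoint_cvg (fun k => ncell_dot (V k) d) (ncell_dot v d).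
Proof.
(* The enumeration of indices is generalised to an arbitrary list, so that the sum unfolds one
   [ncell_add] at a time. *)
move=> Vv; rewrite /ncell_dot; elim: (index_enum _) => [|j s IHs].
  under eq_fun do rewrite big_nil.
  by rewrite big_nil; exact: endpoint_cvg_cst.
under eq_fun do rewrite big_cons.
rewrite big_cons; apply: endpoint_cvg_add IHs.
exact/endpoint_cvg_scale/dist_cvg_endpoint/Vv.
Qed.

(** Each endpoint of [g] is a fixed upper bound, and weak inequalities pass to limits of real
    sequences. *)
Lemma endpoint_cvg_le U u g : endpoint_cvg U u ->
  (forall k, ncell_le (U k) g) -> ncell_le u g.
Proof.
move=> Uu Ug i r r01; have [Ul Uu'] := Uu i r r01.
by split; [apply: (cvgr_to_le Ul)|apply: (cvgr_to_le Uu')];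
  apply: nearW => k; have [] := Ug k i r r01.
Qed.

End endpoint_convergence.

Theorem theorem3p20 (R : realType) (n m : nat) (M : set 'rV[R]_m)
    (F : M -> ncell R n) (t : M) :
  M !=set0 -> ncell_vec_closed (subdifferential F t).
Proof.
(* The subgradient [V 0] supplies the g-difference [g] that serves as the common bound for the whole
   sequence. *)
move=> _ V v SV Vv z; have [g [gdiff_g _]] := SV 0%N z.
exists g; split=> //.
apply: (endpoint_cvg_le (endpoint_cvg_dot (val z - val t) Vv)) => k.
(* Each [V k] comes with its own g-difference [h]; its levels agree with those of [g], so the
   inequality carries over to [g]. *)
have [h [gdiff_h]] := SV k z; apply: ncell_le_level => r r01.
exact: gdiff_level_unique r01 gdiff_h gdiff_g.
Qed.
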